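(* Let $1\le k\le m$ and $n\ge2$ be integers. Then $$d_H(A_1,\ldots,A_n)=\Big(\det\big(\langle A_i,A_j\rangle_H\big)_{i,j=1}^n\Big)^{1/2}$$ defines a pseudo $n$-metric on the Stiefel manifold $$\mathrm{St}(k,m)=\{A\in L(\mathbb{R}^k,\mathbb{R}^m):A^\star A=I_k\}.$$
   Context: $L(\mathbb{R}^k,\mathbb{R}^m)$ is the space of linear maps from $\mathbb{R}^k$ to $\mathbb{R}^m$, $A^\star$ is the transpose (adjoint) of $A$, and $\langle A,B\rangle_H=\frac1k\sum_{j=1}^k\langle Ae_j,Be_j\rangle_2$ is the scaled Hilbert–Schmidt inner product, where $(e_j)_{j=1}^k$ is any orthonormal basis of $\mathbb{R}^k$ and $\langle\cdot,\cdot\rangle_2$ is the Euclidean inner product of $\mathbb{R}^m$. For $n\ge2$ and a set $X$, a map $d:X^n\to\mathbb{R}$ is a pseudo $n$-metric on $X$ if (i) $d(x_1,\ldots,x_n)=0$ whenever $x_i=x_j$ for some $i\ne j$; (ii) $d(x_{\pi(1)},\ldots,x_{\pi(n)})=d(x_1,\ldots,x_n)$ for all permutations $\pi$ of $\{1,\ldots,n\}$; (iii) $d(x_1,\ldots,x_n)\le\sum_{i=1}^n d(x_1,\ldots,x_{i-1},y,x_{i+1},\ldots,x_n)$ for all $x_1,\ldots,x_n,y\in X$. *)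

(* Defs.v *)
From mathcomp Require Import all_boot all_order all_fingroup all_algebra.
From mathcomp Require Import polyrcf reals.

Set Implicit Arguments.
Unset Strict Implicit.
Unset Printing Implicit Defensive.

Import Order.TTheory GRing.Theory Num.Theory.
Local Open Scope ring_scope.

(* A point of X^n is a function 'I_n -> X. *)
Definition pseudo_nmetric (R : realType) (X : Type) (n : nat)
    (d : ('I_n -> X) -> R) : Prop :=
  [/\ forall (x : 'I_n -> X) (i j : 'I_n), i != j -> x i = x j -> d x = 0,
      forall (x : 'I_n -> X) (s : 'S_n), d (fun i => x (s i)) = d x
    & forall (x : 'I_n -> X) (y : X),
        d x <= \sum_(i < n) d (fun j => if j == i then y else x j)].

Definition dotp (R : realType) (m : nat) (u v : 'cV[R]_m) : R :=
  \sum_(i < m) u i 0 * v i 0.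

(* A matrix A : 'M_(m, k) stands for the linear map u |-> A *m u on columns,
   and delta_mx j 0 is the j-th vector of the standard basis of 'cV_k; any
   other orthonormal basis gives the same value, see hs_dot_basis. *)
Definition hs_dot (R : realType) (m k : nat) (A B : 'M[R]_(m, k)) : R :=
  k%:R^-1 * \sum_(j < k) dotp (A *m delta_mx j 0) (B *m delta_mx j 0).

Definition d_H (R : realType) (m k n : nat) (A : 'I_n -> 'M[R]_(m, k)) : R :=
  Num.sqrt (\det (\matrix_(i < n, j < n) hs_dot (A i) (A j))).

Definition stiefel (R : realType) (k m : nat) : Type :=
  {A : 'M[R]_(m, k) | A^T *m A == 1%:M}.

Lemma dotpE (R : realType) m (u v : 'cV[R]_m) : dotp u v = \tr (u^T *m v).
Proof.
by rewrite /mxtrace big_ord1 mxE; apply: eq_bigr => i _; rewrite mxE.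
Qed.

Lemma sum_dotp_basis (R : realType) m k (A B : 'M[R]_(m, k))
    (e : 'I_k -> 'cV[R]_k) :
  (forall i j, dotp (e i) (e j) = (i == j)%:R) ->
  \sum_(j < k) dotp (A *m e j) (B *m e j) = \tr (A^T *m B).
Proof.
move=> e_on; pose E := \matrix_(i, j) e j i 0.
have EtE : E^T *m E = 1%:M.
  apply/matrixP => i j; rewrite !mxE -e_on.
  by apply: eq_bigr => l _; rewrite !mxE.
rewrite -[in RHS](mulmx1 (A^T *m B)) -(mulmx1C EtE) mulmxA mxtrace_mulC.
rewrite /mxtrace; apply: eq_bigr => j _.
rewrite !mulmxA -trmx_mul -mulmxA mxE; apply: eq_bigr => i _.
have mulE (C : 'M[R]_(m, k)) : (C *m e j) i 0 = (C *m E) i j.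
  by rewrite !mxE; apply: eq_bigr => l _; rewrite mxE.
by rewrite !mulE [in RHS]mxE.
Qed.

Lemma dotp_delta (R : realType) k (i j : 'I_k) :
  dotp (delta_mx i 0) (delta_mx j 0 : 'cV[R]_k) = (i == j)%:R.
Proof.
rewrite /dotp (bigD1 i) //= big1 => [|l li].
  by rewrite !mxE !eqxx mul1r addr0 andbT.
by rewrite !mxE (negPf li) mul0r.
Qed.

Lemma hs_dotE (R : realType) m k (A B : 'M[R]_(m, k)) :
  hs_dot A B = k%:R^-1 * \tr (A^T *m B).
Proof. by rewrite /hs_dot (sum_dotp_basis _ _ (@dotp_delta R k)). Qed.

Lemma hs_dot_basis (R : realType) m k (A B : 'M[R]_(m, k))
    (e : 'I_k -> 'cV[R]_k) :
  (forall i j, dotp (e i) (e j) = (i == j)%:R) ->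
  hs_dot A B = k%:R^-1 * \sum_(j < k) dotp (A *m e j) (B *m e j).
Proof. by move=> e_on; rewrite hs_dotE (sum_dotp_basis _ _ e_on). Qed.

Lemma det_mulmx_tr_ge0 (R : rcfType) n p (M : 'M[R]_(n, p)) :
  0 <= \det (M *m M^T).
Proof.
case: n M => [|n] M; first by rewrite det_mx00 ler01.
set G := M *m M^T; pose q := char_poly (- G).
have q0 : q.[0] = \det G.
  by rewrite horner_coef0 char_poly_det -detZ scaleN1r opprK.
have sq_ge0 l (w : 'rV[R]_l) : 0 <= (w *m w^T) 0 0.
  by rewrite mxE sumr_ge0 // => i _; rewrite mxE -expr2 sqr_ge0.
have noroot t : 0 < t -> ~~ root q t.
  move=> t0; rewrite -eigenvalue_root_char; apply/negP => /eigenvalueP[v vG].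
  case/negP; apply/eqP/rowP => i; rewrite mxE; apply/eqP; rewrite -sqrf_eq0.
  have : t * (v *m v^T) 0 0 = - (v *m M *m (v *m M)^T) 0 0.
    have /(congr1 (fun w => (w *m v^T) 0 0)) := vG.
    rewrite -scalemxAl [RHS]mxE => <-.
    by rewrite mulmxN mulNmx mxE trmx_mul /G !mulmxA.
  move=> h; have vv0 : (v *m v^T) 0 0 = 0.
    apply: le_anti; rewrite sq_ge0 andbT -(pmulr_rle0 _ t0) h oppr_le0.
    exact: sq_ge0.
  have := vv0; rewrite mxE => /eqP; rewrite psumr_eq0.
    by move=> /allP/(_ i (mem_index_enum i)); rewrite mxE -expr2.
  by move=> j _; rewrite mxE -expr2 sqr_ge0.
have lcq : lead_coef q = 1 by apply/eqP; exact: char_poly_monic.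
rewrite -q0 leNgt; apply/negP => qlt0.
have [|N HN] := @poly_pinfty_gt_lc R q; first by rewrite lcq ltr01.
have leN : 0 <= Num.max N 0 by rewrite le_max lexx orbT.
have qN : 0 <= q.[Num.max N 0].
  by apply: le_trans (HN _ _); rewrite ?lcq ?ler01 // le_max lexx.
have [|x /andP[x0 _] rx] := Num.Theory.poly_ivt leN (p := q).
  by rewrite (ltW qlt0) qN.
move: x0; rewrite le_eqVlt => /orP[/eqP x0|/noroot]; last by rewrite rx.
by move: rx; rewrite -x0 rootE (lt_eqF qlt0).
Qed.

(* The radicand in d_H is never negative, so the convention that Num.sqrt is 0
   on negative numbers plays no role. *)
Lemma gram_hs_ge0 (R : realType) m k n (A : 'I_n -> 'M[R]_(m, k)) :
  0 <= \det (\matrix_(i < n, j < n) hs_dot (A i) (A j)).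
Proof.
pose M : 'M[R]_(n, m * k) := \matrix_i (Num.sqrt k%:R^-1 *: mxvec (A i)).
suff -> : \matrix_(i < n, j < n) hs_dot (A i) (A j) = M *m M^T.
  exact: det_mulmx_tr_ge0.
apply/matrixP => i j; rewrite [LHS]mxE hs_dotE [RHS]mxE.
rewrite (eq_bigr (fun l => k%:R^-1 * (mxvec (A i) 0 l * mxvec (A j) 0 l))).
  rewrite -mulr_sumr; congr (_ * _); rewrite (reindex _ (curry_mxvec_bij m k)).
  rewrite /mxtrace (eq_bigr (fun b => \sum_a A i a b * A j a b)).
    by rewrite exchange_big pair_bigA; apply: eq_bigr => -[a b] _;
      rewrite !mxvecE.
  by move=> b _; rewrite mxE; apply: eq_bigr => a _; rewrite mxE.
by move=> l _; rewrite !mxE mulrACA -expr2 sqr_sqrtr // invr_ge0 ler0n.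
Qed.

(* Main.v *)
Require Import Defs.
From mathcomp Require Import all_boot all_order all_fingroup all_algebra.
From mathcomp Require Import reals.
From mathcomp Require Import lra.

(** Vectorizing matrices turns d_H into the volume sqrt(det G) of the
    parallelotope spanned by vectors v_1, .., v_n, and points of the Stiefel
    manifold into unit vectors.  For the simplex inequality we may assume that
    the v_i are independent.  Write y = sum_j c_j v_j + w with w orthogonal to
    all v_j.  A shear does not change the volume, so replacing v_i by y or by
    u_i = c_i v_i + w gives the same volume, whose square is
    c_i^2 det G + |w|^2 det G', where G' is G without its i-th row and column.
    Since |v_i| = 1, det G' >= det G, so this is at least |u_i|^2 det G.  Finally
    sum_i |u_i| >= sum_i <u_i, y> = |y - w|^2 + n |w|^2 >= |y|^2 = 1. *)

Set Implicit Arguments.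
Unset Strict Implicit.
Unset Printing Implicit Defensive.

Import Order.TTheory GRing.Theory Num.Theory.
Local Open Scope ring_scope.

Lemma cofactor_eq_row (R : pzRingType) n (A B : 'M[R]_n) (i j : 'I_n) :
  (forall l h, l != i -> A l h = B l h) -> cofactor A i j = cofactor B i j.
Proof.
move=> eAB; rewrite /cofactor; congr (_ * \det _); apply/matrixP => l h.
by rewrite !mxE eAB // eq_sym neq_lift.
Qed.

(** Cofactors along row [i] do not see that row, so here they are those of the identity matrix,
    whose adjugate is again the identity. *)
Lemma det1_row (R : comNzRingType) n (i : 'I_n) (c : 'I_n -> R) :
  \det (\matrix_(l, j) (if l == i then c j else (l == j)%:R)) = c i.
Proof.
have adj1 : \adj (1%:M : 'M[R]_n) = 1%:M.
  by rewrite -[LHS]mul1mx mul_mx_adj det1.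
rewrite (expand_det_row _ i) (bigD1 i) //= mxE eqxx big1 => [|j ji].
  rewrite (@cofactor_eq_row _ _ _ 1%:M) => [|l h /negPf li]; last by rewrite !mxE li.
  by have /matrixP/(_ i i) := adj1; rewrite !mxE eqxx => ->; rewrite mulr1 addr0.
rewrite (@cofactor_eq_row _ _ _ 1%:M) => [|l h /negPf li]; last by rewrite !mxE li.
by have /matrixP/(_ j i) := adj1; rewrite !mxE (negPf ji) => ->; rewrite mulr0.
Qed.

Lemma det_add_diag (R : comNzRingType) n (A B : 'M[R]_n) (i : 'I_n) (a : R) :
  (forall l j, B l j = A l j + a *+ ((l == i) && (j == i))) ->
  \det B = \det A + a * cofactor A i i.
Proof.
move=> eB; rewrite (expand_det_row B i) (expand_det_row A i).
rewrite (eq_bigr (fun j => A i j * cofactor A i j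
                           + (a *+ (j == i)) * cofactor A i j)) => [|j _].
  rewrite big_split /=; congr (_ + _); rewrite (bigD1 i) //= eqxx big1 ?addr0 //.
  by move=> j /negPf ->; rewrite mulr0n mul0r.
rewrite eB eqxx /= mulrDl; congr (_ * _ + _ * _); apply: cofactor_eq_row => l h /negPf li;
  by rewrite eB li addr0.
Qed.

Section Dotp.
Variables (R : realType) (p : nat).
Implicit Types u v w : 'cV[R]_p.

Lemma dotpC u v : dotp u v = dotp v u.
Proof. by apply: eq_bigr => i _; rewrite mulrC. Qed.

Lemma dotpDl u v w : dotp (u + v) w = dotp u w + dotp v w.
Proof. by rewrite -big_split; apply: eq_bigr => i _; rewrite mxE mulrDl. Qed.

Lemma dotpDr u v w : dotp u (v + w) = dotp u v + dotp u w.
Proof. by rewrite dotpC dotpDl !(dotpC u). Qed.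

Lemma dotpZl a u v : dotp (a *: u) v = a * dotp u v.
Proof. by rewrite mulr_sumr; apply: eq_bigr => i _; rewrite mxE mulrA. Qed.

Lemma dotpZr a u v : dotp u (a *: v) = a * dotp u v.
Proof. by rewrite dotpC dotpZl (dotpC u). Qed.

Lemma dotpBl u v w : dotp (u - v) w = dotp u w - dotp v w.
Proof. by rewrite -scaleN1r dotpDl dotpZl mulN1r. Qed.

Lemma dotp_suml n (f : 'I_n -> 'cV[R]_p) v :
  dotp (\sum_i f i) v = \sum_i dotp (f i) v.
Proof.
by rewrite exchange_big; apply: eq_bigr => i _; rewrite summxE mulr_suml.
Qed.

Lemma dotp_ge0 u : 0 <= dotp u u.
Proof. by apply: sumr_ge0 => i _; rewrite -expr2 sqr_ge0. Qed.

(** Cauchy-Schwarz against a unit vector: the residual of [u] after projection onto [v] has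
    nonnegative squared norm. *)
Lemma dotp_unit_le u v : dotp v v = 1 -> dotp u v ^+ 2 <= dotp u u.
Proof.
move=> v1; have := dotp_ge0 (u - dotp u v *: v).
rewrite dotpBl dotpZl ![dotp _ (_ - _)]dotpC !dotpBl !dotpZl v1 (dotpC v u).
by set a := dotp u v; nra.
Qed.

Definition gram n (v : 'I_n -> 'cV[R]_p) : 'M[R]_n :=
  \matrix_(i, j) dotp (v i) (v j).

(* Entry (i, i) of the inverse Gram matrix is the squared norm of the dual
   vector of v i, whose inner product with v i is 1. *)
Lemma det_gram_le_cofactor n (v : 'I_n -> 'cV[R]_p) (i : 'I_n) :
  0 < \det (gram v) -> dotp (v i) (v i) = 1 ->
  \det (gram v) <= cofactor (gram v) i i.
Proof.
move=> G0 vi; set G := gram v in G0 *; pose H := invmx G.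
have Gu : G \in unitmx by rewrite unitmxE unitfE gt_eqF.
have -> : cofactor G i i = \det G * H i i.
  have : \adj G = \det G *: H.
    by rewrite -[LHS]mulmx1 -(mulmxV Gu) mulmxA mul_adj_mx mul_scalar_mx.
  by move=> /matrixP/(_ i i); rewrite !mxE.
pose u := \sum_j H i j *: v j.
have uv l : dotp u (v l) = (i == l)%:R.
  have /matrixP/(_ i l) := mulVmx Gu; rewrite !mxE => <-.
  by rewrite dotp_suml; apply: eq_bigr => j _; rewrite dotpZl mxE.
have uu : dotp u u = H i i.
  rewrite {1}/u dotp_suml (bigD1 i) //= dotpZl dotpC uv eqxx mulr1 big1 ?addr0 //.
  by move=> j ji; rewrite dotpZl dotpC uv eq_sym (negPf ji) mulr0.
rewrite ler_peMr ?(ltW G0) // -uu.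
by have := dotp_unit_le u vi; rewrite uv eqxx expr1n.
Qed.

Lemma det_gram_replace n (v : 'I_n -> 'cV[R]_p) (c : 'I_n -> R) w (i : 'I_n) :
  (forall j, dotp w (v j) = 0) ->
  \det (gram (fun j => if j == i then \sum_l c l *: v l + w else v j)) =
  c i ^+ 2 * \det (gram v) + dotp w w * cofactor (gram v) i i.
Proof.
move=> wv; set y := _ + w; set z := fun j => _.
(* [P] turns the family [v] into [t], the family with the [w] component left out; its determinant is
   [c i]. *)
pose P := \matrix_(l, j) (if l == i then c j else (l == j)%:R).
pose t j := \sum_l P j l *: v l.
have tv j : j != i -> t j = v j.
  move=> /negPf ji; rewrite /t (bigD1 j) //= mxE ji eqxx scale1r big1 ?addr0 //.
  by move=> l /negPf lj; rewrite mxE ji eq_sym lj scale0r.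
have zt j : z j = t j + w *+ (j == i).
  rewrite /z; case: eqVneq => [->|ji]; last by rewrite tv // addr0.
  by congr (_ + _); apply: eq_bigr => l _; rewrite mxE eqxx.
have wt j : dotp (t j) w = 0.
  by rewrite dotp_suml big1 // => l _; rewrite dotpZl dotpC wv mulr0.
have tE : gram t = P *m gram v *m P^T.
  apply/matrixP => l j; rewrite !mxE /t dotpC dotp_suml; apply: eq_bigr => h _.
  rewrite dotpZl dotpC dotp_suml [P^T _ _]mxE mulrC; congr (_ * _).
  by rewrite mxE; apply: eq_bigr => q _; rewrite dotpZl [gram v _ _]mxE.
(* Since [w] is orthogonal to every [t j], adding it to [t i] changes only entry (i, i) of the Gram
   matrix. *)
rewrite (@det_add_diag _ _ (gram t) _ i (dotp w w)) => [|l j].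
  rewrite tE !det_mulmx det_tr det1_row mulrAC -expr2 -tE; congr (_ + _ * _).
  (* This minor omits index [i], the only one at which [t] and [v] can differ. *)
  rewrite /cofactor; congr (_ * \det _); apply/matrixP => l h.
  by rewrite !mxE !tv // eq_sym neq_lift.
rewrite !mxE !zt; case: (l == i); case: (j == i); rewrite /= ?mulr0n ?mulr1n ?addr0 //.
- by rewrite dotpDl !dotpDr !wt (dotpC w (t j)) wt addr0 add0r.
- by rewrite dotpDl (dotpC w) wt addr0.
- by rewrite dotpDr wt addr0.
Qed.

Lemma gram_simplex n (v : 'I_n -> 'cV[R]_p) y :
  (0 < n)%N -> (forall i, dotp (v i) (v i) = 1) -> dotp y y = 1 ->
  Num.sqrt (\det (gram v)) <=
    \sum_i Num.sqrt (\det (gram (fun j => if j == i then y else v j))).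
Proof.
move=> n0 v1 y1; have [G0|G0] := leP (\det (gram v)) 0.
  (* Degenerate case: [Num.sqrt] is 0 on nonpositive numbers, so the left side vanishes. *)
  by rewrite ler0_sqrtr // sumr_ge0 // => i _; rewrite sqrtr_ge0.
have Gu : gram v \in unitmx by rewrite unitmxE unitfE gt_eqF.
(* Coefficients of the orthogonal projection of [y] onto the span of [v], solving the normal
   equations. *)
pose c l := ((\row_j dotp y (v j)) *m invmx (gram v)) 0 l.
pose w := y - \sum_l c l *: v l.
have yE : \sum_l c l *: v l + w = y by rewrite addrC subrK.
have wv j : dotp w (v j) = 0.
  rewrite dotpBl dotp_suml; apply/eqP; rewrite subr_eq0; apply/eqP.
  have /rowP/(_ j) := mulmxKV Gu (\row_j dotp y (v j)).
  by rewrite mxE [RHS]mxE => <-; apply: eq_bigr => l _; rewrite dotpZl [gram v _ _]mxE.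
have wy : dotp w y = dotp w w.
  rewrite -{1}yE dotpC dotpDl dotp_suml big1 ?add0r // => l _.
  by rewrite dotpZl dotpC wv mulr0.
clearbody w.
have le_i i : Num.sqrt (\det (gram v)) * (c i * dotp (v i) y + dotp w w) <=
    Num.sqrt (\det (gram (fun j => if j == i then y else v j))).
  set a := _ + dotp w w.
  (* Here [a] is the inner product of [c i *: v i + w] with the unit vector [y]. *)
  have a2 : a ^+ 2 <= c i ^+ 2 + dotp w w.
    have := dotp_unit_le (c i *: v i + w) y1.
    rewrite {1}dotpDl dotpZl wy -/a => /le_trans; apply.
    rewrite dotpDl !dotpDr !dotpZl !dotpZr v1 (dotpC (v i) w) wv.
    by rewrite !mulr0 addr0 add0r mulr1 expr2.
  (* As [a] may be negative, it is bounded by its absolute value, the root of [a ^+ 2]; then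
     radicands are compared. *)
  apply: le_trans (ler_norm _) _; rewrite -sqrtr_sqr ler_wsqrtr //.
  rewrite exprMn sqr_sqrtr ?(ltW G0) // -{1}yE (det_gram_replace _ _ wv).
  have := det_gram_le_cofactor G0 (v1 i); have := dotp_ge0 w.
  move=> w0 cof; apply: le_trans (ler_wpM2l (ltW G0) a2) _.
  by rewrite mulrDr mulrC lerD2l mulrC ler_wpM2l.
apply: le_trans (ler_sum _ (fun i _ => le_i i)).
rewrite -mulr_sumr ler_peMr ?sqrtr_ge0 // big_split /= sumr_const card_ord.
have -> : \sum_i c i * dotp (v i) y = 1 - dotp w w.
  rewrite -y1 -wy -dotpBl (_ : y - w = \sum_l c l *: v l) ?dotp_suml.
    by apply: eq_bigr => i _; rewrite dotpZl.
  by rewrite -yE addrK.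
(* What remains is |w|^2 <= n |w|^2, which holds because n is positive. *)
rewrite -lerBlDl opprB addrC subrK -[leLHS]mulr1n.
by rewrite ler_wpMn2l ?dotp_ge0.
Qed.

End Dotp.

Definition hs_vec (R : realType) m k (A : 'M[R]_(m, k)) : 'cV[R]_(m * k) :=
  Num.sqrt k%:R^-1 *: (mxvec A)^T.

Lemma dotp_hs_vec (R : realType) m k (A B : 'M[R]_(m, k)) :
  dotp (hs_vec A) (hs_vec B) = hs_dot A B.
Proof.
rewrite hs_dotE dotpZl dotpZr mulrA -expr2 sqr_sqrtr ?invr_ge0 ?ler0n //.
congr (_ * _); rewrite /dotp (reindex _ (curry_mxvec_bij m k)) /=.
rewrite /mxtrace (eq_bigr (fun b => \sum_a A a b * B a b)) => [|b _].
  rewrite exchange_big pair_bigA; apply: eq_bigr => -[a b] _.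
  by rewrite !mxE !mxvecE mulrC.
by rewrite mxE; apply: eq_bigr => a _; rewrite mxE.
Qed.

Lemma d_H_gram (R : realType) m k n (A : 'I_n -> 'M[R]_(m, k)) :
  d_H A = Num.sqrt (\det (gram (fun i => hs_vec (A i)))).
Proof.
by congr (Num.sqrt (\det _)); apply/matrixP => i j; rewrite !mxE dotp_hs_vec.
Qed.

(** The squared norm is tr(I_k) / k; positivity of [k] excludes the default inverse of 0. *)
Lemma hs_vec_stiefel (R : realType) k m (A : stiefel R k m) :
  (0 < k)%N -> dotp (hs_vec (sval A)) (hs_vec (sval A)) = 1.
Proof.
move=> k0; rewrite dotp_hs_vec hs_dotE (eqP (svalP A)) mxtrace1 mulVf //.
by rewrite pnatr_eq0 -lt0n.
Qed.

Theorem corollary4p4 (R : realType) (k m n : nat)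
    (hk : (1 <= k)%N) (hkm : (k <= m)%N) (hn : (2 <= n)%N) :
  pseudo_nmetric (fun A : 'I_n -> stiefel R k m => d_H (fun i => sval (A i))).
Proof.
split=> [A i j ij eA|A s|A B].
- rewrite /d_H (determinant_alternate ij) ?sqrtr0 // => l.
  by rewrite !mxE eA.
- rewrite /d_H; set G := \matrix_(i, j) hs_dot (sval (A i)) _.
  (* The same permutation acts on rows and columns, so its sign appears twice and cancels. *)
  rewrite (_ : \matrix_(i, j) _ = row_perm s (col_perm s G)).
    rewrite row_permE col_permE !det_mulmx !det_perm odd_permV mulrCA.
    by rewrite -signr_addb addbb mulr1.
  by apply/matrixP => i j; rewrite !mxE.
- rewrite d_H_gram; apply: le_trans (gram_simplex (y := hs_vec (sval B)) _ _ _) _.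
  + exact: ltnW hn.
  + by move=> i; apply: hs_vec_stiefel.
  + exact: hs_vec_stiefel.
  apply: ler_sum => i _; rewrite d_H_gram le_eqVlt; apply/orP; left; apply/eqP.
  congr (Num.sqrt (\det _)); apply/matrixP => a b; rewrite !mxE.
  by case: (a == i); case: (b == i).
Qed.
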